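(* Suppose $X$ is a L\'evy process with $0<EX_1\le E|X_1|<\infty$ and $\tau_u=\inf\{t>0:X_t>u\}$, $u>0$. Then $\tau_u/u$ are uniformly integrable as $u\to\infty$, i.e. $$\lim_{x\to\infty}\limsup_{u\to\infty}E\left(\frac{\tau_u}{u}\mathbf 1_{\{\tau_u/u>x\}}\right)=0.$$
   Context: $X=(X_t)_{t\ge0}$ is a real L\'evy process with $X_0=0$. Standing assumption of the paper: its L\'evy measure $\Pi_X$ is not identically zero (and $X$ is not the negative of a subordinator). *)

(* Defs.v *)
From HB Require Import structures.
From mathcomp Require Import all_boot all_order all_algebra.
From mathcomp Require Import all_classical all_reals all_analysis.

Set Implicit Arguments.
Unset Strict Implicit.
Unset Printing Implicit Defensive.

Import Order.TTheory GRing.Theory Num.Theory.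
Import numFieldNormedType.Exports.

Local Open Scope classical_set_scope.
Local Open Scope ring_scope.

(* Processes are indexed by the whole of [R]; every condition below concerns  *)
(* times [t >= 0] only, so values of [X] at negative times are irrelevant.     *)

(* The product rule is required for the full family only: since the sets [B i] *)
(* may be [setT], this contains the rule for every subfamily.                  *)
Definition independent_family d (T : measurableType d) (R : realType)
    (P : probability T R) (n : nat) (Y : 'I_n -> T -> R) : Prop :=
  forall B : 'I_n -> set R, (forall i, measurable (B i)) ->
    P (\bigcap_(i in [set: 'I_n]) (Y i @^-1` B i))
    = (\prod_(i < n) P (Y i @^-1` B i))%E.

Definition cadlag (R : realType) (x : R -> R) : Prop :=
  (forall t, 0 <= t -> x s @[s --> t^'+] --> x t) /\
  (forall t, 0 < t -> cvg (x s @[s --> t^'-])).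

Record levy_process d (T : measurableType d) (R : realType)
    (P : probability T R) (X : R -> T -> R) : Prop := LevyProcess {
  levy_measurable : forall t, 0 <= t -> measurable_fun setT (X t) ;
  levy_start : {ae P, forall w, X 0 w = 0} ;
  levy_independent : forall (n : nat) (t : nat -> R),
    0 <= t 0%N -> (forall i, t i <= t i.+1) ->
    independent_family P (fun (i : 'I_n) w => X (t i.+1) w - X (t i) w) ;
  levy_stationary : forall s t, 0 <= s -> 0 <= t ->
    forall B, measurable B ->
      P ((fun w => X (s + t) w - X s w) @^-1` B) = P (X t @^-1` B) ;
  levy_cadlag : {ae P, forall w, cadlag (X ^~ w)} }.

Definition subordinator d (T : measurableType d) (R : realType)
    (P : probability T R) (X : R -> T -> R) : Prop :=
  levy_process P X /\
  {ae P, forall w, forall s t, 0 <= s -> s <= t -> X s w <= X t w}.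

(* Real and imaginary parts of the Levy-Khintchine exponent                    *)
(*   i theta gamma - sigma2 theta^2 / 2                                        *)
(*   + \int (e^{i theta x} - 1 - i theta x 1_{|x| <= 1}) Pi(dx);               *)
(* [\int[Pi]_x] denotes here the real-valued integral.                         *)
Definition levy_exponent_re (R : realType) (sigma2 : R)
    (Pi : {measure set R -> \bar R}) (theta : R) : R :=
  - (sigma2 * theta ^+ 2) / 2 + \int[Pi]_x (cos (theta * x) - 1).

Definition levy_exponent_im (R : realType) (gamma : R)
    (Pi : {measure set R -> \bar R}) (theta : R) : R :=
  theta * gamma +
  \int[Pi]_x (sin (theta * x) - theta * x * \1_[set y : R | `|y| <= 1] x).

(* [E exp (i theta X_t) = exp (t Psi theta)], split into real and imaginary    *)
(* parts.                                                                      *)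
Record levy_triplet d (T : measurableType d) (R : realType)
    (P : probability T R) (X : R -> T -> R)
    (gamma sigma2 : R) (Pi : {measure set R -> \bar R}) : Prop := LevyTriplet {
  triplet_sigma2_ge0 : 0 <= sigma2 ;
  triplet_origin : Pi [set 0] = 0%E ;
  triplet_integrable :
    (\int[Pi]_x (Num.min 1 (x ^+ 2))%:E < +oo)%E ;
  triplet_cos : forall t theta, 0 <= t ->
    ('E_P[fun w => cos (theta * X t w)])%E =
    (expR (t * levy_exponent_re sigma2 Pi theta)
     * cos (t * levy_exponent_im gamma Pi theta))%:E ;
  triplet_sin : forall t theta, 0 <= t ->
    ('E_P[fun w => sin (theta * X t w)])%E =
    (expR (t * levy_exponent_re sigma2 Pi theta)
     * sin (t * levy_exponent_im gamma Pi theta))%:E }.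

Definition levy_measure d (T : measurableType d) (R : realType)
    (P : probability T R) (X : R -> T -> R)
    (Pi : {measure set R -> \bar R}) : Prop :=
  exists gamma sigma2 : R, levy_triplet P X gamma sigma2 Pi.

(* [+oo] when the level [u] is never exceeded. *)
Definition passage_time (T : Type) (R : realType) (X : R -> T -> R) (u : R)
    (w : T) : \bar R :=
  ereal_inf [set t%:E | t in [set t : R | 0 < t /\ u < X t w]].

(* Main.v *)
Require Import Defs.
From HB Require Import structures.
From mathcomp Require Import all_boot all_order all_algebra.
From mathcomp Require Import all_classical all_reals all_analysis.
From mathcomp Require Import measurable_realfun ring lra.

Set Implicit Arguments.
Unset Strict Implicit.
Unset Printing Implicit Defensive.

Import Order.TTheory GRing.Theory Num.Theory.
Import numFieldNormedType.Exports.

Local Open Scope classical_set_scope.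
Local Open Scope ring_scope.

(** Only the values of [X] at integer times matter. With
    [Y i = X (i + 1) - X i], the walk [Y 0 + .. + Y (k - 1)] equals [X k] almost
    surely and has independent steps with the law of [X 1] and mean [mu > 0].
    If the passage time of [u] exceeds [k], then almost surely the walk has
    stayed below [u] up to time [k] (the event [below Y u k]). As soon as
    [tau_u >= 4 n] and [tau_u >= 2], [tau_u] is at most four times the number of
    [k >= n] for which [X] has not exceeded [u] at the times [1], .., [k]
    ([passage_time_le_sum]), and everything reduces to bounding
    [\sum_(k >= n) P (below Y u k)] for [n] close to [x u / 4].

    That sum is controlled by Wald's identity over a time window
    ([drift_sum_below_le]). Replace the steps by [y = min Y c]. While the capped
    walk [s] is below [u], a step leads at most to [u + c], so
    [\sum_(n <= k < m) 1_(below k) y k <= (u + c - s n)^+]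
    ([stopped_sum_le]). Since [below k] depends on the first [k] steps only,
    taking means gives
    [E y * \sum_(n <= k < m) P (below k) <= E (u + c - s n)^+].

    If [x] is at least [16 / mu], then [n mu] exceeds [u] by a fixed factor, and
    the right-hand side is the mean of a deviation of [s n] below its drift. It
    is [o(u)] by the law of large numbers in mean
    ([Rintegral_shortfall_le]): the step [y] is a bounded variable, to which the
    variance bound applies, minus a nonnegative one whose mean is small when [c]
    is large. Therefore the limit superior in [u] is already [0] for every
    [x >= 16 / mu].

    The passage time is an infimum over uncountably many times and need not be
    measurable. Its integral is then a lower integral, which is still monotone
    ([ge0_le_lower_integral]), so comparison with a measurable series of
    indicators suffices. *)

(** * Products of independent random variables *)

Section product_rule.
Context d (T : measurableType d) (R : realType) (P : probability T R).
Variables U W : T -> R.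
Hypotheses (iU : P.-integrable setT (EFin \o U))
           (iW : P.-integrable setT (EFin \o W)).
Hypothesis UW : forall A B, measurable A -> measurable B ->
  P (U @^-1` A `&` W @^-1` B) = (P (U @^-1` A) * P (W @^-1` B))%E.

Let mU : measurable_fun setT U.
Proof. exact/measurable_EFinP/(measurable_int _ iU). Qed.
Let mW : measurable_fun setT W.
Proof. exact/measurable_EFinP/(measurable_int _ iW). Qed.

Let UWf w := (U w, W w).
Let mUW : measurable_fun setT UWf. Proof. exact/measurable_fun_pair. Qed.

Let rU : {RV P >-> R} := HB.pack U (isMeasurableFun.Build _ _ _ _ U mU).
Let rW : {RV P >-> R} := HB.pack W (isMeasurableFun.Build _ _ _ _ W mW).
Let rUW : {mfun T >-> (R * R)%type} :=
  HB.pack UWf (isMeasurableFun.Build _ _ _ _ UWf mUW).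

Let mulf (z : R * R) : \bar R := (z.1 * z.2)%:E.

Let mmulf : measurable_fun setT mulf.
Proof. by apply/measurable_EFinP/measurable_funM. Qed.

Let mabs_mulf : measurable_fun setT (abse \o mulf).
Proof. exact: measurableT_comp. Qed.

(** The product rule on rectangles determines the joint law: it is the product
    of the two marginals, so that both statements below are instances of
    Fubini's theorem. *)
Let jointE A : measurable A ->
  (distribution P rU \x distribution P rW)%E A = distribution P rUW A.
Proof.
apply: (@product_measure_unique _ _ _ _ _ (distribution P rU)
  (distribution P rW) (distribution P rUW)) => A1 A2 mA1 mA2.
by rewrite /distribution /pushforward/= -UW.
Qed.

Let mabs : measurable_fun setT (fun y : R => (`|y|%R)%:E).
Proof. by apply/measurable_EFinP; exact: normr_measurable. Qed.

Let integrable_law (V : {RV P >-> R}) : P.-integrable setT (EFin \o V) ->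
  (distribution P V).-integrable setT (@EFin R).
Proof.
move=> /integrableP[_ V_fin]; apply/integrableP; split => //.
by rewrite ge0_integral_distribution.
Qed.

Let integrable_mulf :
  (distribution P rU \x distribution P rW)%E.-integrable setT mulf.
Proof.
have /integrableP[_ U_fin] := integrable_law (V := rU) iU.
have /integrableP[_ W_fin] := integrable_law (V := rW) iW.
apply/integrable12ltyP => //=.
under eq_integral => x _.
  under eq_integral => y _ do rewrite normrM EFinM.
  rewrite ge0_integralZl//.
  over.
rewrite ge0_integralZr//; last exact: integral_ge0.
apply: lte_mul_pinfty; [exact: integral_ge0| |exact: W_fin].
by rewrite ge0_fin_numE ?integral_ge0//; exact: U_fin.
Qed.

Lemma integrable_mul_indep : P.-integrable setT (EFin \o (U \* W)).
Proof.
apply/integrableP; split; first by apply/measurable_EFinP/measurable_funM.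
have -> : (\int[P]_w `|(EFin \o (U \* W)%R) w| =
    \int[distribution P rUW]_z `|mulf z|)%E.
  by rewrite ge0_integral_distribution.
rewrite -(eq_measure_integral _ (fun A mA _ => jointE mA)).
by have /integrableP[] := integrable_mulf.
Qed.

Lemma Rintegral_mul_indep :
  \int[P]_w (U w * W w) = \int[P]_w U w * \int[P]_w W w.
Proof.
have intE (V : {RV P >-> R}) : P.-integrable setT (EFin \o V) ->
    (\int[distribution P V]_y y%:E = \int[P]_w (V w)%:E)%E.
  by move=> iV; rewrite integral_distribution.
have iUW := integrable_mul_indep.
rewrite /Rintegral -fineM; [|exact: integrable_fin_num..].
congr fine.
have -> : (\int[P]_w (U w * W w)%:E = \int[distribution P rUW]_z mulf z)%E.
  by rewrite integral_distribution.
rewrite -(eq_measure_integral _ (fun A mA _ => jointE mA)).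
rewrite -(integral12_prod_meas1 integrable_mulf) /fubini_F.
pose EW := (\int[P]_w (W w)%:E)%E.
have EW_fin : EW \is a fin_num by exact: integrable_fin_num.
transitivity (\int[distribution P rU]_x (x%:E * EW))%E.
  apply: eq_integral => x _.
  transitivity (\int[distribution P rW]_y (x%:E * y%:E))%E.
    by apply: eq_integral => y _; rewrite -EFinM.
  rewrite (integralZl _ (f := EFin))// ?(intE rW)//.
  exact: (integrable_law (V := rW) iW).
rewrite -(fineK EW_fin) integralZr//; last exact: (integrable_law (V := rU) iU).
by rewrite (intE rU)// fineK.
Qed.

End product_rule.

(** * The past of a sequence of random variables *)

Section past.
Context d (T : measurableType d) (R : realType) (P : probability T R).
Variable Y : nat -> T -> R.

(** The events that constrain each of [Y 0], .., [Y (k - 1)] separately; they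
    are stable under intersection. *)
Definition cylinders (k : nat) : set (set T) :=
  [set E | exists2 B : nat -> set R, (forall i, measurable (B i)) &
     E = \bigcap_(i in `I_k) (Y i @^-1` B i)].

(** The sample space with the sigma-algebra generated by the first [k]
    variables. Making it a type of its own lets measurability with respect to
    the past be derived from the general lemmas on measurable functions. *)
Definition past (k : nat) := g_sigma_algebraType (cylinders k).

HB.instance Definition _ k := Measurable.on (past k).

Hypothesis mY : forall i, measurable_fun setT (Y i).

Lemma cylinder_preimage i k B : (i < k)%N -> measurable B ->
  cylinders k (Y i @^-1` B).
Proof.
move=> ik mB; exists (fun j => if j == i then B else setT).
  by move=> j; case: ifP.
apply/seteqP; split => [w Bw j /= jk|w /(_ i ik)] /=.
  by case: eqVneq => // ->.
by rewrite eqxx.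
Qed.

Lemma measurable_fun_past i k : (i < k)%N ->
  measurable_fun [set: past k] (Y i : past k -> R).
Proof.
move=> ik _ B mB; rewrite setTI.
by apply: sub_sigma_algebra; exact: cylinder_preimage.
Qed.

Lemma measurable_past k (A : set (past k)) :
  measurable A -> measurable (A : set T).
Proof.
apply: smallest_sub; first exact: sigma_algebra_measurable.
move=> _ [B mB ->]; apply: bigcap_measurableType => i _.
by rewrite -[X in measurable X]setTI; exact: mY.
Qed.

Lemma measurable_fun_of_past k (f : T -> R) :
  measurable_fun [set: past k] (f : past k -> R) -> measurable_fun setT f.
Proof. by move=> mf _ B mB; apply: measurable_past; exact: mf. Qed.

Lemma cylinders_setI k : setI_closed (cylinders k).
Proof.
move=> _ _ [B mB ->] [C mC ->]; exists (fun i => B i `&` C i).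
  by move=> i; exact: measurableI.
by rewrite -bigcapI.
Qed.

Hypothesis indY : forall n, independent_family P (fun i : 'I_n => Y i).

Lemma cylinders_indep k A B : cylinders k A -> measurable B ->
  P (A `&` Y k @^-1` B) = (P A * P (Y k @^-1` B))%E.
Proof.
move=> [C mC ->] mB.
pose D i := if (i < k)%N then C i else B.
have mD i : measurable (D i) by rewrite /D; case: ifP.
have bigcapE n (E : nat -> set R) :
    \bigcap_(i in `I_n) (Y i @^-1` E i) =
    \bigcap_(i in [set: 'I_n]) (Y i @^-1` E i).
  apply/seteqP; split => [w Ew i _|w Ew i /= ik].
    exact: (Ew i (ltn_ord i)).
  exact: (Ew (Ordinal ik) I).
have -> : \bigcap_(i in `I_k) (Y i @^-1` C i) `&` Y k @^-1` B =
    \bigcap_(i in `I_k.+1) (Y i @^-1` D i).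
  apply/seteqP; split => [w [Cw Bw] i /= |w Dw].
    rewrite ltnS leq_eqVlt => /predU1P[->|ik]; first by rewrite /D ltnn /=.
    by rewrite /D ik; exact: Cw.
  split => [i /= ik|]; last by have := Dw k (ltnSn k); rewrite /D/= ltnn.
  by have := Dw i (ltnW ik); rewrite /D/= ik.
rewrite !bigcapE (indY (B := fun i => D i))// big_ord_recr/=.
rewrite (indY (B := fun i => C i))//; congr (_ * _)%E.
  by apply: eq_bigr => i _; rewrite /D ltn_ord.
by rewrite /D ltnn.
Qed.

(** Independence on cylinders propagates to all events of the past, because the
    events satisfying the product rule form a Dynkin system. *)
Lemma past_indep k (A : set (past k)) B : measurable A -> measurable B ->
  P (A `&` Y k @^-1` B) = (P A * P (Y k @^-1` B))%E.
Proof.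
move=> mA mB; have mYB : measurable (Y k @^-1` B).
  by rewrite -[X in measurable X]setTI; exact: mY.
apply: (@dynkin_induction _ (past k) (cylinders k)
  (fun A => P (A `&` Y k @^-1` B) = (P A * P (Y k @^-1` B))%E)) => //.
- exact: cylinders_setI.
- by rewrite setTI probability_setT mul1e.
- by move=> C cC; exact: cylinders_indep.
- move=> S /measurable_past mS PS.
  rewrite [X in P X](_ : _ = Y k @^-1` B `\` (S : set T)); last first.
    by rewrite setIC setDE.
  rewrite measureD//; last by rewrite ltey_eq fin_num_measure.
  rewrite [X in (_ - X)%E](_ : _ = (P S * P (Y k @^-1` B))%E); last first.
    by rewrite setIC; exact: PS.
  rewrite probability_setC// muleBl ?mul1e//.
  by rewrite fin_num_measure.
- move=> F mF tF PF; have {}mF n := measurable_past (mF n).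
  rewrite setI_bigcupl measure_bigcup//=; last 2 first.
  + by move=> n _; exact: measurableI.
  + exact: trivIset_setIr.
  rewrite measure_bigcup//.
  rewrite (eq_eseriesr
    (g := fun n => ((fine (P (Y k @^-1` B)))%:E * P (F n))%E)).
    by rewrite nneseriesZl// fineK ?fin_num_measure// muleC.
  by move=> n _; rewrite fineK ?fin_num_measure// muleC; exact: PF.
Qed.

End past.

(** * Partial sums and the time spent below a level *)

Definition walk (T : Type) (R : realType) (y : nat -> T -> R) (k : nat) (w : T)
  : R := \sum_(i < k) y i w.

(** The event that the first passage of the walk above [u] happens after time
    [k]. *)
Definition below (T : Type) (R : realType) (y : nat -> T -> R) (u : R)
  (k : nat) : set T := [set w | forall j, (j <= k)%N -> walk y j w <= u].

Lemma walkS (T : Type) (R : realType) (y : nat -> T -> R) k w :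
  walk y k.+1 w = walk y k w + y k w.
Proof. by rewrite /walk big_ord_recr. Qed.

Lemma below_bigcap (T : Type) (R : realType) (y : nat -> T -> R) u k :
  below y u k = \bigcap_(j in `I_k.+1) (walk y j @^-1` `]-oo, u]).
Proof.
apply/seteqP; split => [w yw j jk|w yw j jk]; first by rewrite /= in_itv/= yw.
by have := yw j jk; rewrite /= in_itv.
Qed.

(** The sum telescopes to the increment of the walk from time [n] to the first
    passage above [u], or to time [m] if that comes earlier, and the walk
    overshoots [u] by at most one step, that is by at most [c]. *)
Lemma stopped_sum_le (T : Type) (R : realType) (y : nat -> T -> R) (c u : R)
    (n m : nat) w : (forall k, y k w <= c) ->
  \sum_(n <= k < m) \1_(below y u k) w * y k w
    <= Num.max 0 (u + c - walk y n w).
Proof.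
move=> yc; have [mn|/ltnW nm] := leqP m n.
  by rewrite big_geq// le_max lexx.
(* The equality is part of the induction: it holds until the passage, and the
   sum stays constant afterwards. *)
suff [] : (w \in below y u m -> \sum_(n <= k < m) \1_(below y u k) w * y k w =
      walk y m w - walk y n w) /\
    \sum_(n <= k < m) \1_(below y u k) w * y k w
    <= Num.max 0 (u + c - walk y n w) by [].
elim: m nm => [|m IH].
  by rewrite leqn0 => /eqP ->; rewrite big_geq// subrr le_max lexx.
rewrite leq_eqVlt => /predU1P[<-|].
  by rewrite big_geq// subrr le_max lexx.
rewrite ltnS => nm; have [IHe IHle] := IH nm.
have sub : w \in below y u m.+1 -> w \in below y u m.
  by rewrite !inE => yw j jm; apply: yw; exact: leqW.
rewrite big_nat_recr//= walkS indicE; case: (boolP (w \in below y u m)) => wm.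
  rewrite mul1r IHe//; split => [_|]; first by lra.
  rewrite le_max; apply/orP; right.
  have : walk y m w <= u by move: wm; rewrite inE => /(_ m (leqnn m)).
  by have := yc m; lra.
by rewrite mul0r addr0; split => // /sub; rewrite (negbTE wm).
Qed.

(** * Means of independent, identically distributed steps *)

Section same_law.
Context d (T : measurableType d) (R : realType) (P : probability T R).
Variables V W : T -> R.
Hypotheses (mV : measurable_fun setT V) (mW : measurable_fun setT W).
Hypothesis VW : forall B, measurable B -> P (V @^-1` B) = P (W @^-1` B).

Let rV : {RV P >-> R} := HB.pack V (isMeasurableFun.Build _ _ _ _ _ mV).
Let rW : {RV P >-> R} := HB.pack W (isMeasurableFun.Build _ _ _ _ _ mW).

Lemma integrable_same_law (f : R -> R) : measurable_fun setT f ->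
  P.-integrable setT (EFin \o (f \o W)) ->
  P.-integrable setT (EFin \o (f \o V)).
Proof.
move=> mf /integrableP[_ fW]; apply/integrableP; split.
  by apply/measurable_EFinP; exact: measurableT_comp.
have mabsf : measurable_fun setT (fun x => `|(f x)%:E|%E).
  by apply: measurableT_comp => //; exact/measurable_EFinP.
move: fW; rewrite -(ge0_integral_distribution rW mabsf)//.
rewrite -(ge0_integral_distribution rV mabsf)//; apply: le_lt_trans.
by rewrite (eq_measure_integral (distribution P rW))// => A mA _; exact: VW.
Qed.

Lemma Rintegral_same_law (f : R -> R) : measurable_fun setT f ->
  P.-integrable setT (EFin \o (f \o W)) ->
  \int[P]_w f (V w) = \int[P]_w f (W w).
Proof.
move=> mf fW; congr fine; have fV := integrable_same_law mf fW.
have mEf : measurable_fun setT (EFin \o f) by exact/measurable_EFinP.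
transitivity (\int[distribution P rV]_x (EFin \o f) x)%E.
  by rewrite integral_distribution.
transitivity (\int[distribution P rW]_x (EFin \o f) x)%E.
  by apply: eq_measure_integral => A mA _; exact: VW.
by rewrite integral_distribution.
Qed.

End same_law.

Section iid.
Context d (T : measurableType d) (R : realType) (P : probability T R).
Variable Y : nat -> T -> R.
Hypothesis mY : forall i, measurable_fun setT (Y i).
Hypothesis indY : forall n, independent_family P (fun i : 'I_n => Y i).
Hypothesis idY : forall i B, measurable B ->
  P (Y i @^-1` B) = P (Y 0%N @^-1` B).

Local Notation steps f := (fun i w => f (Y i w)).

(** The form in which independence is used: a variable [U] known at time [k]
    against a function of the next step. *)
Lemma Rintegral_past_mul k (U : T -> R) (f : R -> R) :
  measurable_fun [set: past Y k] (U : past Y k -> R) ->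
  P.-integrable setT (EFin \o U) ->
  measurable_fun setT f -> P.-integrable setT (EFin \o (f \o Y 0%N)) ->
  P.-integrable setT (EFin \o (fun w => U w * f (Y k w))) /\
  \int[P]_w (U w * f (Y k w)) = \int[P]_w U w * \int[P]_w f (Y 0%N w).
Proof.
move=> mU iU mf iY0.
have iYk := integrable_same_law (mY k) (mY 0%N) (idY k) mf iY0.
have ind A B : measurable A -> measurable B ->
    P (U @^-1` A `&` (f \o Y k) @^-1` B) =
    (P (U @^-1` A) * P ((f \o Y k) @^-1` B))%E.
  move=> mA mB; rewrite comp_preimage; apply: (past_indep mY indY).
    by rewrite -[X in measurable X]setTI; exact: mU.
  by rewrite -[X in measurable X]setTI; exact: mf.
split; first exact: (integrable_mul_indep iU iYk ind).
rewrite -(Rintegral_same_law (mY k) (mY 0%N) (idY k) mf iY0).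
exact: (Rintegral_mul_indep iU iYk ind).
Qed.

Lemma measurable_walk_past (f : R -> R) j k : measurable_fun setT f ->
  (j <= k)%N ->
  measurable_fun [set: past Y k] (walk (steps f) j : past Y k -> R).
Proof.
move=> mf jk; apply: measurable_sum => i.
apply: measurableT_comp => //; apply: measurable_fun_past.
exact: leq_trans (ltn_ord i) jk.
Qed.

Lemma measurable_below_past (f : R -> R) u k : measurable_fun setT f ->
  measurable (below (steps f) u k : set (past Y k)).
Proof.
move=> mf; rewrite below_bigcap; apply: bigcap_measurableType => j jk.
by rewrite -[X in measurable X]setTI; exact: measurable_walk_past.
Qed.

Lemma measurable_walk (f : R -> R) k : measurable_fun setT f ->
  measurable_fun setT (walk (steps f) k).
Proof.
move=> mf; apply: (measurable_fun_of_past mY).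
exact: (measurable_walk_past mf (leqnn k)).
Qed.

Lemma measurable_below (f : R -> R) u k : measurable_fun setT f ->
  measurable (below (steps f) u k).
Proof.
by move=> mf; apply: (measurable_past mY); exact: measurable_below_past.
Qed.

End iid.

(** * Integrable real-valued random variables *)

Section Rintegral_tools.
Context d (T : measurableType d) (R : realType) (P : probability T R).

Local Notation int f := (P.-integrable setT (EFin \o f)).

Lemma integrable_addr (f g : T -> R) :
  int f -> int g -> int (fun w => f w + g w).
Proof. by move=> iF ig; exact: (integrableD measurableT iF ig). Qed.

Lemma integrable_subr (f g : T -> R) :
  int f -> int g -> int (fun w => f w - g w).
Proof. by move=> iF ig; exact: (integrableB measurableT iF ig). Qed.

Lemma integrable_mull k (f : T -> R) : int f -> int (fun w => k * f w).
Proof. by move=> iF; exact: (integrableZl measurableT k iF). Qed.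

Lemma integrable_const (k : R) : int (fun=> k).
Proof. exact: finite_measure_integrable_cst. Qed.

Lemma Rintegral_const (k : R) : \int[P]_w (fun=> k) w = k.
Proof.
rewrite Rintegral_cst//= [X in fine X](_ : _ = 1%E) ?mulr1//.
exact: probability_setT.
Qed.

Lemma integrable_le (f g : T -> R) : measurable_fun setT f ->
  (forall w, `|f w| <= `|g w|) -> int g -> int f.
Proof.
move=> mf fg; apply: le_integrable => //; first exact/measurable_EFinP.
by move=> w _; rewrite lee_fin.
Qed.

Lemma integrable_meas (f : T -> R) : int f -> measurable_fun setT f.
Proof. by move=> iF; exact/measurable_EFinP/(measurable_int _ iF). Qed.

Lemma Rintegral_sumr (h : nat -> T -> R) (s : seq nat) :
  (forall i, int (h i)) ->
  int (fun w => \sum_(i <- s) h i w) /\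
  \int[P]_w (\sum_(i <- s) h i w) = \sum_(i <- s) \int[P]_w h i w.
Proof.
move=> ih; elim: s => [|i s [IHi IHe]].
  have -> : (fun w => \sum_(i <- [::]) h i w) = fun=> 0.
    by apply/funext => w; rewrite big_nil.
  rewrite big_nil; split; first exact: integrable_const.
  exact: (Rintegral_const 0).
have -> : (fun w => \sum_(j <- i :: s) h j w) =
    fun w => h i w + \sum_(j <- s) h j w.
  by apply/funext => w; rewrite big_cons.
split; first exact: integrable_addr.
by rewrite big_cons -IHe -RintegralD.
Qed.

Lemma integrable_walk (h : nat -> T -> R) n :
  (forall i, int (h i)) -> int (walk h n).
Proof.
move=> ih; have [+ _] := Rintegral_sumr (iota 0 n) ih.
apply: eq_integrable => // w _ /=.
by rewrite /walk -(big_mkord xpredT (fun i => h i w)) /index_iota subn0.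
Qed.

Lemma Rintegral_walk (h : nat -> T -> R) n :
  (forall i, int (h i)) -> \int[P]_w walk h n w = \sum_(i < n) \int[P]_w h i w.
Proof.
move=> ih; have [_] := Rintegral_sumr (iota 0 n) ih.
rewrite -(big_mkord xpredT (fun i => \int[P]_w h i w)) /index_iota subn0 => <-.
apply: eq_Rintegral => w _ /=.
by rewrite /walk -(big_mkord xpredT (fun i => h i w)) /index_iota subn0.
Qed.

Lemma Rintegral_indic (A : set T) : measurable A ->
  \int[P]_w \1_A w = fine (P A).
Proof. by move=> mA; rewrite /Rintegral integral_indic// setIT. Qed.

Lemma Rintegral_excess_small (f : T -> R) : int f -> forall e, 0 < e ->
  exists2 c, 0 < c & \int[P]_w Num.max 0 (`|f w| - c) <= e.
Proof.
move=> iF e e0; have mf := integrable_meas iF.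
pose g (n : nat) w := (Num.max 0 (`|f w| - n.+1%:R))%:E.
have mg n : measurable_fun setT (g n).
  apply/measurable_EFinP; apply: measurable_maxr => //.
  by apply: measurable_funB => //; exact: measurableT_comp.
have g_cvg w : g ^~ w @ \oo --> 0%E.
  apply: cvg_near_cst; near=> n; rewrite /g; congr EFin; apply/max_idPl.
  rewrite subr_le0; apply: (@le_trans _ _ n%:R); last by rewrite ler_nat.
  by near: n; exact: nbhs_infty_ger.
have [//||||_ _] := @dominated_convergence _ T R P setT measurableT g
  (cst 0%E) (abse \o (EFin \o f)) mg.
- by apply: aeW => w _; exact: g_cvg.
- exact: integrable_abse.
- apply: aeW => w n _; rewrite /g /= lee_fin ger0_norm ?le_max ?lexx//.
  by rewrite ge_max normr_ge0 gerBl ler0n.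
have e0' : (\int[P]_w cst 0%E w < e%:E)%E by rewrite integral0 lte_fin.
move=> /(_ _ (open_ereal_lt' e0')) [n _ /(_ n (leqnn n))] /= ltn.
exists n.+1%:R => //; rewrite -lee_fin /Rintegral fineK; first exact: ltW.
rewrite ge0_fin_numE; first exact: (lt_trans ltn (ltry e)).
by apply: integral_ge0 => w _; rewrite lee_fin le_max lexx.
Unshelve. all: by end_near. Qed.

Lemma integrable_bounded (f : T -> R) (K : R) : measurable_fun setT f ->
  (forall w, `|f w| <= K) -> int f.
Proof.
move=> mf fK; apply: measurable_bounded_integrable => //.
  by rewrite ltey_eq fin_num_measure.
exists K; split; first exact: num_real.
by move=> M KM w _ /=; exact: (le_trans (fK w) (ltW KM)).
Qed.

End Rintegral_tools.

(** * Truncation of a real number *)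

Section truncation.
Context (R : realType) (c : R).

Definition cap (x : R) := Num.min x c.
Definition clip (x : R) := Num.max (- c) (Num.min x c).
Definition deficit (x : R) := Num.max 0 (- c - x).
Definition excess (x : R) := Num.max 0 (`|x| - c).

Lemma measurable_cap : measurable_fun setT cap.
Proof. exact: measurable_minr. Qed.

Lemma measurable_clip : measurable_fun setT clip.
Proof. by apply: measurable_maxr => //; exact: measurable_minr. Qed.

Lemma measurable_deficit : measurable_fun setT deficit.
Proof. by apply: measurable_maxr => //; exact: measurable_funB. Qed.

Lemma cap_le x : cap x <= c.
Proof. by rewrite /cap ge_min lexx orbT. Qed.

Lemma cap_le_id x : cap x <= x.
Proof. by rewrite /cap ge_min lexx. Qed.

Lemma sub_excess_le_cap x : x - excess x <= cap x.
Proof.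
have := ler_norm x; rewrite /excess /cap.
by have [?|?] := leP x c; have [?|?] := leP 0 (`|x| - c); lra.
Qed.

Lemma deficit_ge0 x : 0 <= deficit x.
Proof. by rewrite /deficit le_max lexx. Qed.

Lemma deficit_le_excess x : deficit x <= excess x.
Proof.
rewrite /deficit /excess ge_max !le_max lexx/=; apply/orP; right.
by have := ler_norm (- x); rewrite normrN; lra.
Qed.

Hypothesis c_gt0 : 0 < c.

(** A step capped from above has a square integrable part [clip x]; what is
    left over is of one sign and has a small mean. *)
Lemma capE x : cap x = clip x - deficit x.
Proof.
rewrite /cap /clip /deficit; have [xc|xc] := leP x c.
  by have [?|?] := leP x (- c); have [?|?] := leP 0 (- c - x); lra.
have c0 := c_gt0.
by rewrite (max_r (x := - c)) ?(max_l (x := 0)); lra.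
Qed.

Lemma normr_clip_le x : `|clip x| <= c.
Proof.
rewrite /clip ler_norml le_max lexx/= ge_max ge_min lexx orbT andbT.
by have := c_gt0; lra.
Qed.

Lemma excess_le_norm x : excess x <= `|x|.
Proof. by rewrite /excess ge_max normr_ge0/= gerBl ltW. Qed.

End truncation.

Section truncation_integrable.
Context d (T : measurableType d) (R : realType) (P : probability T R).
Variable (V : T -> R) (c : R).
Hypotheses (iV : P.-integrable setT (EFin \o V)) (c_gt0 : 0 < c).

Let mV : measurable_fun setT V. Proof. exact: (integrable_meas iV). Qed.

Lemma integrable_excess : P.-integrable setT (EFin \o (excess c \o V)).
Proof.
apply: (integrable_le _ _ iV) => [|w /=].
  apply: measurable_maxr => //; apply: measurable_funB => //.
  exact: measurableT_comp.
by rewrite ger0_norm ?excess_le_norm// /excess le_max lexx.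
Qed.

Lemma integrable_deficit : P.-integrable setT (EFin \o (deficit c \o V)).
Proof.
apply: (integrable_le _ _ integrable_excess) => [|w /=].
  exact: (measurableT_comp (@measurable_deficit _ c) mV).
have := deficit_le_excess c (V w) => le.
by rewrite !ger0_norm ?deficit_ge0// (le_trans _ le)// deficit_ge0.
Qed.

Lemma integrable_clip : P.-integrable setT (EFin \o (clip c \o V)).
Proof.
apply: (integrable_bounded _ (measurableT_comp (@measurable_clip _ c) mV)).
by move=> w; exact: normr_clip_le.
Qed.

Lemma integrable_cap : P.-integrable setT (EFin \o (cap c \o V)).
Proof.
have := integrable_subr integrable_clip integrable_deficit.
by apply: eq_integrable => // w _ /=; rewrite capE.
Qed.

Lemma Rintegral_capE : \int[P]_w cap c (V w) =
  \int[P]_w clip c (V w) - \int[P]_w deficit c (V w).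
Proof.
rewrite -RintegralB//; [|exact: integrable_clip|exact: integrable_deficit].
by apply: eq_Rintegral => w _; rewrite capE.
Qed.

Lemma Rintegral_deficit_le :
  \int[P]_w deficit c (V w) <= \int[P]_w excess c (V w).
Proof.
apply: le_Rintegral => [//|||w _]; last exact: deficit_le_excess.
- exact: integrable_deficit.
- exact: integrable_excess.
Qed.

Lemma Rintegral_cap_ge :
  \int[P]_w V w - \int[P]_w excess c (V w) <= \int[P]_w cap c (V w).
Proof.
rewrite -RintegralB//; last exact: integrable_excess.
apply: le_Rintegral => [//|||w _]; last exact: sub_excess_le_cap.
- exact: (integrable_subr iV integrable_excess).
- exact: integrable_cap.
Qed.

Lemma normr_Rintegral_clip_le : `|\int[P]_w clip c (V w)| <= c.
Proof.
apply: (le_trans (le_normr_Rintegral _ integrable_clip)) => //.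
rewrite -[leRHS](Rintegral_const P); apply: le_Rintegral => //.
- by apply: integrable_norm => //; exact: integrable_clip.
- exact: integrable_const.
- by move=> w _; exact: normr_clip_le.
Qed.

End truncation_integrable.

(** * Random walks with integrable steps *)

Lemma oppr_le_sqr (R : realType) (eta q : R) : 0 < eta ->
  - q <= eta + eta^-1 * q ^+ 2.
Proof.
move=> eta0; have [qe|qe] := leP (- q) eta.
  by rewrite (le_trans qe)// lerDl mulr_ge0 ?invr_ge0 ?sqr_ge0 ?ltW.
rewrite -lerBlDl (@le_trans _ _ (- q))//; first by rewrite gerBl ltW.
by rewrite mulrC ler_pdivlMr//; nra.
Qed.

Section random_walk.
Context d (T : measurableType d) (R : realType) (P : probability T R).
Variable Y : nat -> T -> R.
Hypothesis mY : forall i, measurable_fun setT (Y i).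
Hypothesis indY : forall n, independent_family P (fun i : 'I_n => Y i).
Hypothesis idY : forall i B, measurable B ->
  P (Y i @^-1` B) = P (Y 0%N @^-1` B).

Local Notation steps f := (fun i w => f (Y i w)).
Local Notation int f := (P.-integrable setT (EFin \o f)).

Let integrable_stepf (f : R -> R) i : measurable_fun setT f ->
  int (f \o Y 0%N) -> int (f \o Y i).
Proof. exact: (integrable_same_law (mY i) (mY 0%N) (idY i)). Qed.

Let integrable_shortfall v (h : nat -> T -> R) n : (forall i, int (h i)) ->
  int (fun w => Num.max 0 (v - walk h n w)).
Proof.
move=> ih; have iW : int (fun w => v - walk h n w).
  by apply: integrable_subr; [exact: integrable_const|exact: integrable_walk].
apply: (integrable_le _ _ iW).
  by apply: measurable_maxr => //; exact: integrable_meas iW.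
move=> w; rewrite [leLHS]ger0_norm ?le_max ?lexx//.
by rewrite ge_max normr_ge0 ler_norm.
Qed.

(** The mean of [stopped_sum_le]. The event [below _ u k] is decided by the
    first [k] steps, hence is independent of step number [k], and each product
    in the sum has mean [P (below _ u k)] times the drift: this is Wald's
    identity for the passage time restricted to the time window between [n]
    and [m]. *)
Lemma drift_sum_below_le (f : R -> R) c u n m : measurable_fun setT f ->
  int (f \o Y 0%N) -> (forall x, f x <= c) ->
  \int[P]_w f (Y 0%N w) * \sum_(n <= k < m) fine (P (below (steps f) u k))
    <= \int[P]_w Num.max 0 (u + c - walk (steps f) n w).
Proof.
move=> mf iY0 fc.
pose h k w := \1_(below (steps f) u k) w * f (Y k w).
have mA k : measurable (below (steps f) u k) by exact: measurable_below.
have hE k : int (h k) /\ \int[P]_w h k w =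
    fine (P (below (steps f) u k)) * \int[P]_w f (Y 0%N w).
  rewrite -Rintegral_indic//.
  apply: (Rintegral_past_mul mY indY idY _ _ mf iY0).
    by apply: measurable_indic; exact: measurable_below_past.
  exact: integrable_indic.
have ih k := (hE k).1.
have [iS SE] := Rintegral_sumr (index_iota n m) ih.
rewrite mulr_sumr (eq_bigr (fun k => \int[P]_w h k w)); last first.
  by move=> k _; rewrite (hE k).2 mulrC.
rewrite -SE; apply: le_Rintegral => //.
  by apply: integrable_shortfall => k; exact: integrable_stepf.
by move=> w _; exact: stopped_sum_le.
Qed.

Lemma normr_walk_le (h : nat -> T -> R) K n w : (forall i w, `|h i w| <= K) ->
  `|walk h n w| <= n%:R * K.
Proof.
move=> hK; apply: (le_trans (ler_norm_sum _ _ _)).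
rewrite mulr_natl -[X in K *+ X]card_ord -sumr_const.
by apply: ler_sum => i _; exact: hK.
Qed.

(** Centred independent steps are orthogonal, so that second moments add up. *)
Lemma Rintegral_walk_sqr_le (f : R -> R) K n : measurable_fun setT f ->
  (forall x, `|f x| <= K) -> \int[P]_w f (Y 0%N w) = 0 ->
  \int[P]_w (walk (steps f) n w ^+ 2) <= n%:R * K ^+ 2.
Proof.
move=> mf fK f0.
have mfY i : measurable_fun setT (f \o Y i) by exact: measurableT_comp.
have iY0 : int (f \o Y 0%N).
  exact: (integrable_bounded _ (mfY 0%N) (fun w => fK _)).
have mW k := measurable_walk mY k mf.
have WK k w := normr_walk_le k w (fun i w => fK (Y i w)).
have iW k : int (walk (steps f) k).
  exact: (integrable_bounded _ (mW k) (WK k)).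
have iWW k : int (fun w => walk (steps f) k w ^+ 2).
  apply: (integrable_bounded _ (K := (k%:R * K) ^+ 2)).
    exact: measurable_funX.
  by move=> w; rewrite normrX lerXn2r// nnegrE ?(le_trans _ (WK k w)).
have iff k : int (fun w => f (Y k w) ^+ 2).
  apply: (integrable_bounded _ (K := K ^+ 2)).
    exact: (measurable_funX 2 (mfY k)).
  by move=> w; rewrite normrX lerXn2r// nnegrE ?(le_trans _ (fK 0)).
elim: n => [|n IH].
  rewrite mul0r (_ : (fun w => _) = fun=> 0) ?Rintegral_const//.
  by apply/funext => w; rewrite /walk big_ord0 expr0n.
have [iX XE] := Rintegral_past_mul mY indY idY
  (measurable_walk_past mf (leqnn n)) (iW n) mf iY0.
have -> : (fun w => walk (steps f) n.+1 w ^+ 2) = fun w =>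
   (walk (steps f) n w ^+ 2 + 2 * (walk (steps f) n w * f (Y n w)))
   + f (Y n w) ^+ 2.
  by apply/funext => w; rewrite walkS; ring.
rewrite RintegralD//; last first.
  by apply: integrable_addr => //; exact: integrable_mull.
rewrite RintegralD//; last exact: integrable_mull.
rewrite RintegralZl// XE f0 !mulr0 addr0 -natr1 mulrDl mul1r lerD//.
rewrite -[leRHS](Rintegral_const P); apply: le_Rintegral => //.
  exact: integrable_const.
move=> w _; rewrite -[f _ ^+ 2]ger0_norm ?sqr_ge0// normrX.
by rewrite lerXn2r// nnegrE ?(le_trans _ (fK 0)).
Qed.

Hypothesis iY : int (Y 0%N).
Variable c : R.
Hypothesis c_gt0 : 0 < c.

Let iclip := integrable_clip iY c_gt0.
Let icap := integrable_cap iY c_gt0.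
Let ideficit := integrable_deficit iY c_gt0.
Let alpha := \int[P]_w clip c (Y 0%N w).
Let centred (x : R) := clip c x - alpha.

Let mcentred : measurable_fun setT centred.
Proof. by apply: measurable_funB => //; exact: measurable_clip. Qed.

Let centred_le x : `|centred x| <= 2 * c.
Proof.
apply: (le_trans (ler_normB _ _)).
have := normr_clip_le c_gt0 x; have := normr_Rintegral_clip_le iY c_gt0.
by rewrite -/alpha; lra.
Qed.

Let Rintegral_centred : \int[P]_w centred (Y 0%N w) = 0.
Proof.
rewrite RintegralB//; last exact: integrable_const.
by rewrite (Rintegral_const P) subrr.
Qed.

Let walk_capE n w : walk (steps (cap c)) n w =
  walk (steps centred) n w + n%:R * alpha - walk (steps (deficit c)) n w.
Proof.
rewrite /walk mulr_natl -[X in alpha *+ X]card_ord -sumr_const -big_split/=.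
by rewrite -sumrB; apply: eq_bigr => i _; rewrite capE// /centred; ring.
Qed.

(** A mean form of the weak law of large numbers for the capped walk, with an
    explicit error. Once the clipped drift has reached [v], a shortfall is due
    either to the fluctuation [q] of the clipped walk, where
    [- q <= eta + q ^+ 2 / eta] brings in the variance, or to the deficits. *)
Lemma Rintegral_shortfall_le eta v n : 0 < eta ->
  v <= n%:R * \int[P]_w clip c (Y 0%N w) ->
  \int[P]_w Num.max 0 (v - walk (steps (cap c)) n w) <=
    eta + n%:R * (2 * c) ^+ 2 / eta + n%:R * \int[P]_w deficit c (Y 0%N w).
Proof.
move=> eta0 drift.
have istepD i := integrable_stepf i (@measurable_deficit _ c) ideficit.
have iD := integrable_walk n istepD.
have mQ := measurable_walk mY n mcentred.
have iQ : int (fun w => walk (steps centred) n w ^+ 2).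
  apply: (integrable_bounded _ (measurable_funX 2 mQ)
    (K := (n%:R * (2 * c)) ^+ 2)) => w.
  have Qw := normr_walk_le n w (fun i w => centred_le (Y i w)).
  by rewrite normrX lerXn2r// nnegrE ?(le_trans _ Qw).
have EQ := Rintegral_walk_sqr_le n mcentred centred_le Rintegral_centred.
have ED : \int[P]_w walk (steps (deficit c)) n w =
    n%:R * \int[P]_w deficit c (Y 0%N w).
  rewrite Rintegral_walk// mulr_natl -[X in _ *+ X]card_ord -sumr_const.
  apply: eq_bigr => i _; rewrite (Rintegral_same_law (mY i) (mY 0%N) (idY i))//.
  exact: measurable_deficit.
have iZQ := integrable_mull eta^-1 iQ.
have iB := integrable_addr (integrable_const P eta) iZQ.
apply: (@le_trans _ _ (\int[P]_w ((eta + eta^-1 * walk (steps centred) n w ^+ 2)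
    + walk (steps (deficit c)) n w))).
  apply: le_Rintegral => //.
  - apply: integrable_shortfall => i; apply: integrable_stepf icap.
    exact: measurable_cap.
  - exact: (integrable_addr iB iD).
  move=> w _; rewrite ge_max walk_capE.
  have D0 : 0 <= walk (steps (deficit c)) n w.
    by apply: sumr_ge0 => i _; exact: deficit_ge0.
  have Q0 := oppr_le_sqr (walk (steps centred) n w) eta0.
  apply/andP; split.
    rewrite addr_ge0// addr_ge0 ?(ltW eta0)//.
    by rewrite mulr_ge0 ?sqr_ge0// invr_ge0 ltW.
  by move: drift; rewrite -/alpha; lra.
rewrite RintegralD// RintegralD//; last exact: integrable_const.
rewrite (Rintegral_const P) RintegralZl// ED lerD2r lerD2l mulrC.
by rewrite ler_pM2r ?invr_gt0.
Qed.

(** Capping the steps slows the walk down, hence only makes the events [below]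
    larger, and costs at most [eps] of drift. *)
Lemma sum_below_le eta eps u n m : 0 < eta ->
  \int[P]_w excess c (Y 0%N w) <= eps ->
  eps <= \int[P]_w Y 0%N w ->
  u + c <= n%:R * (\int[P]_w Y 0%N w - eps) ->
  (\int[P]_w Y 0%N w - eps) * \sum_(n <= k < m) fine (P (below Y u k))
    <= eta + n%:R * (2 * c) ^+ 2 / eta + n%:R * eps.
Proof.
move=> eta0 exc_eps; set mu := \int[P]_w Y 0%N w => epsmu drift.
have def_eps : \int[P]_w deficit c (Y 0%N w) <= eps.
  exact: le_trans (Rintegral_deficit_le iY c_gt0) exc_eps.
have cap_mu : mu - eps <= \int[P]_w cap c (Y 0%N w).
  by apply: le_trans (Rintegral_cap_ge iY c_gt0); rewrite lerD2l lerN2.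
have cap_alpha : \int[P]_w cap c (Y 0%N w) <= alpha.
  rewrite Rintegral_capE// gerBl.
  by apply: Rintegral_ge0 => w _; exact: deficit_ge0.
have below_sub k : below Y u k `<=` below (steps (cap c)) u k.
  move=> w Yw j jk; apply: le_trans (Yw j jk); apply: ler_sum => i _.
  exact: cap_le_id.
have sum_le : \sum_(n <= k < m) fine (P (below Y u k)) <=
    \sum_(n <= k < m) fine (P (below (steps (cap c)) u k)).
  apply: ler_sum => k _.
  have m1 := measurable_below mY u k (f := idfun) (@measurable_id _ _ _).
  have m2 := measurable_below mY u k (@measurable_cap _ c).
  apply: fine_le; [exact: fin_num_measure..|].
  by apply: le_measure; rewrite ?inE//; exact: below_sub.
apply: (@le_trans _ _ (\int[P]_w cap c (Y 0%N w) *
    \sum_(n <= k < m) fine (P (below (steps (cap c)) u k)))).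
  apply: ler_pM => //; first by rewrite subr_ge0.
  by apply: sumr_ge0 => k _; exact: fine_ge0.
apply: (le_trans (drift_sum_below_le u n m _ icap (cap_le c))).
  exact: measurable_cap.
apply: (le_trans (Rintegral_shortfall_le eta0 _)).
  apply: (le_trans drift); apply: ler_wpM2l => //.
  exact: le_trans cap_mu cap_alpha.
by rewrite lerD2l ler_wpM2l.
Qed.

End random_walk.

Section random_walk_tail.
Context d (T : measurableType d) (R : realType) (P : probability T R).
Variable Y : nat -> T -> R.
Hypothesis mY : forall i, measurable_fun setT (Y i).
Hypothesis indY : forall n, independent_family P (fun i : 'I_n => Y i).
Hypothesis idY : forall i B, measurable B ->
  P (Y i @^-1` B) = P (Y 0%N @^-1` B).
Hypothesis iY : P.-integrable setT (EFin \o Y 0%N).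

Local Notation mu := (\int[P]_w Y 0%N w).

(** [sum_below_le] with [eps] small against [mu], then [c] with
    [E (|Y| - c)^+ <= eps], [eta = eps u] and [n] close to [x u / 4]. Its
    right-hand side becomes [eps u + x c ^+ 2 / eps + x u eps / 4], which is
    [O(eps u)] as soon as [u >= x c ^+ 2 / eps ^+ 2]. The drift condition
    [u + c <= n (mu - eps)] follows from [mu - eps >= mu / 2] and
    [x mu >= 16], which make the right-hand side at least [2 u - mu / 2]. *)
Lemma tail_sum_below_small x e : 0 < mu -> 16 <= x * mu -> 0 < e ->
  exists2 u0, 0 < u0 & forall u m, u0 <= u ->
    4 / u * \sum_(Num.truncn (x * u / 4) <= k < m) fine (P (below Y u k)) <= e.
Proof.
move=> mu0 xmu e0.
have x0 : 0 < x by rewrite -(pmulr_lgt0 x mu0); lra.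
pose eps := Num.min (mu / 2) (e * mu / (8 * (2 + x))).
have eps0 : 0 < eps.
  by rewrite lt_min !divr_gt0 ?mulr_gt0// addr_gt0.
have eps_mu : eps <= mu / 2 by rewrite ge_min lexx.
have eps_e : 8 * (2 + x) * eps <= e * mu.
  by rewrite -ler_pdivlMl ?mulr_gt0 ?addr_gt0// mulrC ge_min lexx orbT.
have [c c0 exc] := Rintegral_excess_small iY eps0.
pose u0 := c + mu / 2 + x * c ^+ 2 / eps ^+ 2.
have xce0 : 0 < x * c ^+ 2 / eps ^+ 2 by rewrite divr_gt0 ?mulr_gt0 ?exprn_gt0.
have u00 : 0 < u0 by rewrite /u0; lra.
exists u0 => // u m u0u; have ugt0 : 0 < u by exact: lt_le_trans u0u.
set n := Num.truncn _.
have /andP[nle ngt] : n%:R <= x * u / 4 < n.+1%:R.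
  by apply: truncn_itv; rewrite divr_ge0// mulr_ge0 ?ltW.
have ux : x * c ^+ 2 <= u * eps ^+ 2.
  by rewrite -ler_pdivrMr ?exprn_gt0//; rewrite /u0 in u0u; lra.
have drift : u + c <= n%:R * (mu - eps).
  have nS : n.+1%:R = n%:R + 1 :> R by rewrite -natr1.
  have n0 : 0 <= n%:R :> R by exact: ler0n.
  have h1 : n%:R * (mu / 2) <= n%:R * (mu - eps) by rewrite ler_wpM2l//; lra.
  have h2 : (x * u / 4 - 1) * (mu / 2) <= n%:R * (mu / 2).
    by rewrite ler_wpM2r//; lra.
  have h3 : 16 * u <= x * mu * u by rewrite ler_pM2r.
  have h4 : (x * u / 4 - 1) * (mu / 2) = (x * mu * u) / 8 - mu / 2 by field.
  rewrite /u0 in u0u; lra.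
have etau : 0 < eps * u by rewrite mulr_gt0.
have le_mu : eps <= mu by lra.
have := sum_below_le mY indY idY iY c0 m etau exc le_mu drift.
set S := \sum_(_ <= k < _) _ => HS.
have S0 : 0 <= S by apply: sumr_ge0 => k _; exact: fine_ge0.
have HS2 : mu / 2 * S <= eps * u + eps * u + x * u / 4 * eps.
  apply: (le_trans (le_trans _ HS)); first by rewrite ler_wpM2r//; lra.
  rewrite lerD//; last by rewrite ler_wpM2r// ltW.
  rewrite lerD2l ler_pdivrMr//.
  apply: (@le_trans _ _ (x * u / 4 * (2 * c) ^+ 2)).
    by rewrite ler_wpM2r ?sqr_ge0.
  have -> : x * u / 4 * (2 * c) ^+ 2 = u * (x * c ^+ 2) by field.
  have -> : eps * u * (eps * u) = u * (u * eps ^+ 2) by ring.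
  by rewrite ler_pM2l.
have HS3 : mu * S <= u * (2 * (2 + x) * eps).
  have : 0 <= u * x * eps by rewrite !mulr_ge0// ltW.
  lra.
rewrite mulrAC ler_pdivrMr// -(ler_pM2l mu0).
have -> : mu * (4 * S) = 4 * (mu * S) by ring.
have h5 := ler_wpM2l (ltW ugt0) eps_e.
by lra.
Qed.
End random_walk_tail.

(** * Passage times of a Levy process *)

(** Neither function has to be measurable: the integral of a nonnegative
    function is a supremum over the simple functions below it. *)
Lemma ge0_le_lower_integral d (T : measurableType d) (R : realType)
    (mu : {measure set T -> \bar R}) (f g : T -> \bar R) :
  (forall w, 0 <= f w)%E -> (forall w, f w <= g w)%E ->
  (\int[mu]_w f w <= \int[mu]_w g w)%E.
Proof.
move=> f0 fg; rewrite !ge0_integralTE//; last first.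
  by move=> w; exact: le_trans (fg w).
apply: ge_ereal_sup => _ [h hf <-]; apply: ereal_sup_ubound.
by exists h => // w; exact: le_trans (fg w).
Qed.

Definition unexceeded (T : Type) (R : realType) (X : R -> T -> R) (u : R)
  (k : nat) : set T :=
  [set w | forall j, (0 < j <= k)%N -> X j%:R w <= u].

Lemma passage_time_ge0 (T : Type) (R : realType) (X : R -> T -> R) u w :
  (0 <= passage_time X u w)%E.
Proof.
by apply: le_ereal_inf_tmp => _ [t [t0 _] <-]; rewrite lee_fin ltW.
Qed.

Lemma unexceeded_lt_passage (T : Type) (R : realType) (X : R -> T -> R) u k w :
  (k%:R%:E < passage_time X u w)%E -> unexceeded X u k w.
Proof.
move=> ktau j /andP[j0 jk]; rewrite leNgt; apply/negP => uX.
have : (passage_time X u w <= j%:R%:E)%E.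
  by apply: ereal_inf_lbound; exists j%:R => //; split => //; rewrite ltr0n.
by rewrite leNgt (le_lt_trans _ ktau)// lee_fin ler_nat.
Qed.

(** If [N] is the integer part of [tau], all [k < N] contribute to the sum, so
    it is at least [N - n >= tau - 1 - n], which is at least [tau / 4] when
    [tau >= 2] and [tau >= 4 n]. *)
Lemma passage_time_le_sum (T : Type) (R : realType) (X : R -> T -> R) u w n :
  (2%:E <= passage_time X u w)%E -> ((4 * n%:R)%:E <= passage_time X u w)%E ->
  (passage_time X u w <=
     4%:E * \sum_(k <oo) (\1_(unexceeded X u (n + k)) w)%:E)%E.
Proof.
set tau := passage_time X u w; set S := (\sum_(k <oo) _)%E => tau2 tau4n.
have S_ge N : (N%:R%:E <= tau -> (N%:R - n%:R)%:E <= S)%E.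
  move=> Ntau; have [Nn|nN] := leqP N n.
    apply: (@le_trans _ _ 0%E); first by rewrite lee_fin subr_le0 ler_nat.
    by apply: nneseries_ge0 => k _ _; rewrite lee_fin.
  apply: (@le_trans _ _
      (\sum_(0 <= k < N - n) (\1_(unexceeded X u (n + k)) w)%:E)%E).
    rewrite big_nat (eq_bigr (fun=> 1%:E)); last first.
      move=> k /andP[_ kN]; congr EFin; rewrite indicE mem_set//.
      apply: unexceeded_lt_passage; apply: lt_le_trans Ntau.
      by rewrite lte_fin ltr_nat -ltn_subRL.
    by rewrite -big_nat sumEFin lee_fin sumr_const_nat subn0 natrB ?(ltnW nN).
  by apply: nneseries_lim_ge => k _; rewrite lee_fin.
have le4 t : 2 <= t -> 4 * n%:R <= t -> (t%:E <= tau -> t%:E <= 4%:E * S)%E.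
  move=> t2 t4n ttau; pose N := Num.truncn t.
  have /andP[Nt tN] : N%:R <= t < N.+1%:R by apply: truncn_itv; lra.
  have := S_ge N; move=> /(_ (le_trans _ ttau)); rewrite lee_fin => /(_ Nt) HS.
  apply: (@le_trans _ _ (4%:E * (N%:R - n%:R)%:E)%E); last first.
    by rewrite lee_pmul2l.
  rewrite -EFinM lee_fin.
  have nS : N.+1%:R = N%:R + 1 :> R by rewrite -natr1.
  lra.
case E : tau tau2 tau4n => [t| |].
- by rewrite !lee_fin => t2 t4n; apply: le4 => //; rewrite E.
- move=> _ _; rewrite leye_eq; apply/eqP/eqyP => A A0.
  apply: (@le_trans _ _ (A + 2 + 4 * n%:R)%:E).
    by rewrite lee_fin; have : 0 <= n%:R :> R by []; lra.
  by apply: le4; rewrite ?E ?leey//; have : 0 <= n%:R :> R by []; lra.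
- by rewrite leeNy_eq.
Qed.

Section levy.
Context d (T : measurableType d) (R : realType) (P : probability T R).
Variable X : R -> T -> R.
Hypothesis X_levy : levy_process P X.

Let mX i : measurable_fun setT (X i%:R).
Proof. exact: (levy_measurable X_levy). Qed.

Definition step i w := X i.+1%:R w - X i%:R w.

Lemma measurable_step i : measurable_fun setT (step i).
Proof. exact: measurable_funB. Qed.

Lemma step_indep n : independent_family P (fun i : 'I_n => step i).
Proof.
apply: (levy_independent X_levy (t := fun i => i%:R)) => // i.
by rewrite ler_nat.
Qed.

Lemma step_law i B : measurable B -> P (step i @^-1` B) = P (X 1 @^-1` B).
Proof.
move=> mB; rewrite -(levy_stationary X_levy (s := i%:R) (t := 1))//.
by rewrite natr1.
Qed.

Lemma measurable_unexceeded u k : measurable (unexceeded X u k).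
Proof.
rewrite [X in measurable X](_ : _ = \bigcap_(j in [set j | (0 < j <= k)%N])
  (X j%:R @^-1` `]-oo, u])).
  apply: bigcap_measurableType => j _.
  by rewrite -[X in measurable X]setTI; exact: mX.
apply/seteqP; split => [w Xw j jk|w Xw j jk]; first by rewrite /= in_itv/= Xw.
by have := Xw j jk; rewrite /= in_itv.
Qed.

(** The walk is [X k - X 0]; it agrees with [X k] off a null set only. *)
Lemma P_unexceeded_le u k : 0 <= u ->
  (P (unexceeded X u k) <= P (below step u k))%E.
Proof.
move=> u0; have [N [mN PN XN]] := levy_start X_levy.
have mB : measurable (below step u k).
  exact: (measurable_below measurable_step u k (f := idfun)
    (@measurable_id _ _ _)).
apply: (@le_trans _ _ (P (below step u k `|` N))).
  apply: le_measure; rewrite ?inE.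
  - exact: measurable_unexceeded.
  - exact: measurableU.
  move=> w Xw; have [X0|X0] := eqVneq (X 0 w) 0; last first.
    by right; apply: XN => /= X0'; rewrite X0' eqxx in X0.
  left => j jk; rewrite /walk.
  rewrite (_ : \sum_(i < j) step i w = X j%:R w); last first.
    elim: j {jk} => [|j IH]; first by rewrite big_ord0 X0.
    by rewrite big_ord_recr/= IH /step addrC subrK.
  by case: j jk => [|j] jk; [rewrite X0|exact: Xw].
apply: (le_trans (measureU2 _ _ _)) => //.
by rewrite [X in (_ + X)%E](_ : _ = 0%E) ?adde0.
Qed.

Definition scaled_passage u w : \bar R := (passage_time X u w * (u^-1)%:E)%E.

Lemma truncated_passage_le x u w : 0 < u -> 2 <= x * u ->
  (scaled_passage u w * (\1_[set w' | (x%:E < scaled_passage u w')%E] w)%:E <=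
   (4 / u)%:E *
     \sum_(k <oo) (\1_(unexceeded X u (Num.truncn (x * u / 4) + k)) w)%:E)%E.
Proof.
move=> u0 xu; set n := Num.truncn _.
have xu4 : 0 <= x * u / 4 by lra.
have /andP[nle _] : n%:R <= x * u / 4 < n.+1%:R by exact: truncn_itv.
rewrite indicE; case: (boolP (w \in _)) => [|_]; last first.
  rewrite mule0; apply: mule_ge0; first by rewrite lee_fin divr_ge0// ltW.
  by apply: nneseries_ge0 => k _ _; rewrite lee_fin.
rewrite inE/= mule1 /scaled_passage => xtau.
have {}xtau : ((x * u)%:E < passage_time X u w)%E.
  by rewrite EFinM -lte_pdivlMr.
rewrite mulrC EFinM -muleA muleC lee_pmul2l ?lte_fin ?invr_gt0//.
apply: passage_time_le_sum; apply: le_trans (ltW xtau); rewrite lee_fin//.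
lra.
Qed.

Lemma integral_truncated_passage_le x u e : 0 < u -> 2 <= x * u ->
  (forall m, 4 / u * \sum_(Num.truncn (x * u / 4) <= k < m)
     fine (P (below step u k)) <= e) ->
  (\int[P]_w (scaled_passage u w *
     (\1_[set w' | (x%:E < scaled_passage u w')%E] w)%:E) <= e%:E)%E.
Proof.
move=> u0 xu He; set n := Num.truncn _ in He *.
apply: (@le_trans _ _ (\int[P]_w ((4 / u)%:E *
     \sum_(k <oo) (\1_(unexceeded X u (n + k)) w)%:E))%E).
  apply: ge0_le_lower_integral => w; last exact: truncated_passage_le.
  apply: mule_ge0; last by rewrite lee_fin.
  by apply: mule_ge0; [exact: passage_time_ge0|rewrite lee_fin invr_ge0 ltW].
have mI k : measurable_fun setT
    (fun w => (\1_(unexceeded X u (n + k)) w)%:E : \bar R).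
  by apply/measurable_EFinP/measurable_indic; exact: measurable_unexceeded.
rewrite ge0_integralZl_EFin//; last 3 first.
- by move=> w _; apply: nneseries_ge0 => k _ _; rewrite lee_fin.
- by apply: ge0_emeasurable_sum => // k w _ _; rewrite lee_fin.
- by rewrite divr_ge0// ltW.
rewrite integral_nneseries//.
have u4 : 0 < 4 / u by rewrite divr_gt0.
rewrite (muleC (4 / u)%:E) -lee_pdivlMr//.
apply: lime_le.
  apply: is_cvg_nneseries => k _ _.
  by apply: integral_ge0 => w _; rewrite lee_fin.
apply: nearW => m /=.
rewrite -EFinM.
apply: (@le_trans _ _
    (\sum_(0 <= k < m) (fine (P (below step u (n + k))))%:E)%E).
  apply: lee_sum => k _.
  rewrite integral_indic ?setIT//; last exact: measurable_unexceeded.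
  rewrite fineK; first exact: P_unexceeded_le (ltW u0).
  apply: fin_num_measure; exact: (measurable_below measurable_step _ _
    (f := idfun) (@measurable_id _ _ _)).
rewrite sumEFin lee_fin ler_pdivlMr// mulrC.
apply: le_trans (He (n + m)%N).
suff -> : \sum_(n <= k < n + m) fine (P (below step u k)) =
    \sum_(0 <= k < m) fine (P (below step u (n + k))) by [].
rewrite -[X in index_iota X]add0n big_addn addKn.
by apply: eq_bigr => k _; rewrite addnC.
Qed.

End levy.

(** The integrals to which this applies can be negative for [u < 0], hence the
    restriction to positive arguments in the first hypothesis. *)
Lemma limf_esup_pinfty_eq0 (R : realType) (F : R -> \bar R) :
  (forall u, 0 < u -> (0 <= F u)%E) ->
  (forall e, 0 < e -> exists u0, forall u, u0 <= u -> (F u <= e%:E)%E) ->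
  limf_esup F +oo = 0%E.
Proof.
move=> F0 Fe; apply/eqP; rewrite eq_le; apply/andP; split.
  apply/lee_addgt0Pr => e e0; rewrite add0e.
  have [u0 Fu0] := Fe _ e0.
  rewrite limf_esupE; apply: ge_ereal_inf.
  exists (ereal_sup (F @` [set u | u0 <= u])).
    exists [set u | u0 <= u] => //; by apply: nbhs_pinfty_ge; rewrite num_real.
  by apply: ge_ereal_sup => _ [u /= uu <-]; exact: Fu0.
rewrite limf_esupE; apply: le_ereal_inf_tmp => _ [V [M [_ MV]] <-].
pose u := Num.max M 0 + 1.
have Mu : M < u by rewrite ltr_pwDr// le_max lexx.
have u0 : 0 < u by rewrite ltr_pwDr// le_max lexx orbT.
apply: (le_trans (F0 u u0)); apply: ereal_sup_ubound.
by exists u => //; exact: MV.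
Qed.

Theorem lemma5p2 (R : realType) (d : measure_display) (T : measurableType d)
    (P : probability T R) (X : R -> T -> R)
    (X_levy : levy_process P X)
    (Pi : {measure set R -> \bar R}) (Pi_levy : levy_measure P X Pi)
    (Pi_neq0 : exists2 B : set R, measurable B & Pi B <> 0%E)
    (X_not_neg_subordinator : ~ subordinator P (fun t w => - X t w))
    (EX1_gt0 : (0 < 'E_P[X 1%R])%E)
    (EX1_le : ('E_P[X 1%R] <= 'E_P[fun w => (`|X 1 w|)%R])%E)
    (EabsX1_fin : ('E_P[fun w => (`|X 1 w|)%R] < +oo)%E) :
  let Z (u : R) (w : T) : \bar R := (passage_time X u w * (u^-1)%:E)%E in
  limf_esup (fun u : R =>
      \int[P]_w (Z u w * (\1_[set w' | (x%:E < Z u w')%E] w)%:E))%E +oo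
    @[x --> +oo] --> 0%E.
Proof.
move=> Z.
have iX1 : P.-integrable setT (EFin \o X 1).
  apply/integrableP; split.
    by apply/measurable_EFinP; exact: (levy_measurable X_levy).
  by move: EabsX1_fin; rewrite unlock.
have mX1 : measurable_fun setT (X 1) by exact: (levy_measurable X_levy).
have mS i := measurable_step X_levy i.
have lawS := step_law X_levy.
have mid : measurable_fun setT (@idfun R) by exact: measurable_id.
have iS : P.-integrable setT (EFin \o step X 0).
  exact: (integrable_same_law (mS 0%N) mX1 (lawS 0%N) mid iX1).
set mu := \int[P]_w step X 0 w.
have mu0 : 0 < mu.
  rewrite /mu (Rintegral_same_law (mS 0%N) mX1 (lawS 0%N) mid iX1).
  move: EX1_gt0; rewrite unlock /Rintegral/= => h.
  by rewrite fine_gt0// h/= -ge0_fin_numE ?ltW//; exact: integrable_fin_num.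
have idS i B : measurable B -> P (step X i @^-1` B) = P (step X 0 @^-1` B).
  by move=> mB; rewrite !lawS.
apply: cvg_near_cst; near=> x.
have xmu : 16 <= x * mu.
  by rewrite -ler_pdivrMr//; near: x;
    apply: nbhs_pinfty_ge; rewrite num_real.
have x0 : 0 < x by rewrite -(pmulr_lgt0 x mu0); lra.
apply: limf_esup_pinfty_eq0 => [u u0|e e0].
  apply: integral_ge0 => w _; apply: mule_ge0; last by rewrite lee_fin.
  by apply: mule_ge0; [exact: passage_time_ge0|rewrite lee_fin invr_ge0 ltW].
have [u0 u00 Hu] :=
  tail_sum_below_small mS (step_indep X_levy) idS iS mu0 xmu e0.
(* The term [2 / x] makes [x u >= 2], whence [tau_u >= 2] on the event. *)
exists (u0 + 2 / x) => u uu; have x2 : 0 < 2 / x by rewrite divr_gt0.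
apply: (integral_truncated_passage_le X_levy); first by lra.
  by rewrite mulrC -ler_pdivrMr//; lra.
by move=> m; apply: Hu; lra.
Unshelve. all: by end_near. Qed.
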